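(* Let $f:\mathsf{On}\to\mathsf{On}$ be a normal function, with hyperation $\mathrm{Hyp}[f]=\langle f^\xi\rangle_{\xi\in\mathsf{On}}$ and Veblen progression $\mathrm{Veb}[f]=\langle f_\xi\rangle_{\xi\in\mathsf{On}}$. If $\alpha=\omega^{\alpha_1}+\dots+\omega^{\alpha_n}$, then $f^\alpha(\zeta)=f_{\alpha_1}\cdots f_{\alpha_n}(\zeta)$ for any ordinal $\zeta$, where juxtaposition denotes composition of functions.
   Context: $\mathsf{On}$ is the class of all ordinals. A function $f:\mathsf{On}\to\mathsf{On}$ is normal if it is strictly increasing and continuous, i.e. $f(\lambda)=\sup_{\xi<\lambda}f(\xi)$ for every limit ordinal $\lambda$. A weak hyperation of a normal function $f$ is a family $\langle g^\xi\rangle_{\xi\in\mathsf{On}}$ of normal functions such that $g^0=\mathrm{id}$, $g^1=f$, and $g^{\xi+\zeta}=g^\xi\circ g^\zeta$ for all ordinals $\xi,\zeta$. The hyperation $\mathrm{Hyp}[f]=\langle f^\xi\rangle_{\xi\in\mathsf{On}}$ of $f$ is the unique (always existing) weak hyperation of $f$ which is pointwise minimal: $f^\xi(\zeta)\le h^\xi(\zeta)$ for every weak hyperation $\langle h^\xi\rangle_{\xi\in\mathsf{On}}$ of $f$ and all ordinals $\xi,\zeta$. The Veblen progression $\mathrm{Veb}[f]=\langle f_\alpha\rangle_{\alpha\in\mathsf{On}}$ is defined by: $f_0=f$ and, for $\alpha>0$, $f_\alpha$ is the normal function enumerating in increasing order the class $\{\xi\mid \forall\beta<\alpha,\ f_\beta(\xi)=\xi\}$.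 *)

(* Defs.v *)
From HB Require Import structures.
From mathcomp Require Import all_boot all_order.
From mathcomp Require Import boolp classical_sets.

Set Implicit Arguments.
Unset Strict Implicit.
Unset Printing Implicit Defensive.

Import Order.TTheory.
Local Open Scope order_scope.
Local Open Scope quotient_scope.
Local Open Scope classical_set_scope.

(* [Node f] denotes the least ordinal strictly above all the [f i].  [I] ranges
   over a fixed universe of "small" types and [tree] lives in the next one, so
   [On] below is the (large) well-order of all small ordinals: every small
   family in it is bounded (see [On_bounded]), every initial segment is small. *)
Inductive tree : Type := Node (I : Type) (f : I -> tree).

(* The rank of [Node f] is at most that of [Node g] iff each [f i] has rank
   below that of [Node g], i.e. at most that of some [g j]. *)
Fixpoint tle (s t : tree) {struct s} : Prop :=
  match s, t with
  | Node A f, Node B g => forall i : A, exists j : B, tle (f i) (g j)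
  end.

Lemma tle_refl t : tle t t.
Proof. by elim: t => I f IH /= i; exists i. Qed.

Lemma tle_trans t s r : tle s t -> tle t r -> tle s r.
Proof.
elim: s t r => I f IH [J g] [K h] /= fg gh i.
have [j fgj] := fg i; have [k ghk] := gh j.
by exists k; apply: IH fgj ghk.
Qed.

Lemma tle_child I (f : I -> tree) i : tle (f i) (Node f).
Proof.
have aux t : forall J (g : J -> tree) j, g j = t -> tle t (Node g).
  elim: t => K h IH J g j gj /= k; exists j; rewrite gj.
  exact: (IH k K h k).
exact: aux (erefl _).
Qed.

Lemma tltP I (f : I -> tree) t : ~ tle (Node f) t <-> exists i, tle t (f i).
Proof.
elim: t I f => J g IH I f; split=> [nfg|[i gf] fg].
  have /existsNP[i fi] : ~ (forall i, exists j, tle (f i) (g j)) by [].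
  exists i; move: fi; case: (f i) => K h /= fi j.
  by apply/(IH j K h) => hj; apply: fi; exists j.
case: (fg i) => j fgj.
case: (f i) gf fgj => K h gf fgj.
by have := (IH j K h).2 (gf j); apply.
Qed.

Lemma tle_total s t : tle s t \/ tle t s.
Proof.
have [|] := pselect (tle s t); first by left.
case: s => I f /tltP[i tf]; right.
exact: tle_trans tf (tle_child f i).
Qed.

Lemma tlt_wf : well_founded (fun s t => ~ tle t s).
Proof.
have acc t s : tle s t -> Acc (fun s t => ~ tle t s) s.
  elim: t s => J g IH s st; constructor=> r nsr.
  have : ~ tle (Node g) r by move=> gr; apply: nsr; apply: tle_trans st gr.
  by case/tltP => j rg; apply: IH rg.
by move=> t; apply: (acc t); apply: tle_refl.
Qed.

HB.instance Definition _ := gen_eqMixin tree.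
HB.instance Definition _ := gen_choiceMixin tree.

Definition teq (s t : tree) : bool := `[< tle s t /\ tle t s >].

Lemma teq_refl : reflexive teq.
Proof. by move=> t; apply/asboolP; split; apply: tle_refl. Qed.

Lemma teq_sym : symmetric teq.
Proof. by move=> s t; apply/asboolP/asboolP => -[]. Qed.

Lemma teq_trans : transitive teq.
Proof.
move=> t s r /asboolP[st ts] /asboolP[tr rt]; apply/asboolP.
by split; [apply: tle_trans st tr|apply: tle_trans rt ts].
Qed.

Canonical teq_equiv := EquivRel teq teq_refl teq_sym teq_trans.

Definition On := {eq_quot teq}.
HB.instance Definition _ := Choice.on On.
HB.instance Definition _ := EqQuotient.on On.

Definition On_le (x y : On) : bool := `[< tle (repr x) (repr y) >].

Lemma On_le_refl : reflexive On_le.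
Proof. by move=> x; apply/asboolP/tle_refl. Qed.

Lemma On_le_anti : antisymmetric On_le.
Proof.
move=> x y /andP[/asboolP xy /asboolP yx].
by rewrite -(reprK x) -(reprK y); apply/eqmodP/asboolP.
Qed.

Lemma On_le_trans : transitive On_le.
Proof.
by move=> y x z /asboolP xy /asboolP yz; apply/asboolP/(tle_trans xy yz).
Qed.

Lemma On_le_total : total On_le.
Proof.
by move=> x y; apply/orP; have [?|?] := tle_total (repr x) (repr y);
  [left|right]; apply/asboolP.
Qed.

Fact On_display : Order.disp_t. Proof. exact: Order.Disp tt tt. Qed.

HB.instance Definition _ := Order.Le_isPOrder.Build On_display On
  On_le_refl On_le_anti On_le_trans.
HB.instance Definition _ := Order.POrder_isTotal.Build On_display On
  On_le_total.

Lemma On_ltP (x y : On) : x < y <-> ~ tle (repr y) (repr x).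
Proof. by rewrite ltNge; split => [/negP xy /asboolP//|xy]; apply/negP=> /asboolP. Qed.

Lemma On_lt_wf : well_founded (fun x y : On => x < y).
Proof.
have aux t : forall x : On, repr x = t -> Acc (fun x y : On => x < y) x.
  elim/(well_founded_ind tlt_wf): t => t IH x xt.
  by constructor=> y /On_ltP yx; apply: (IH (repr y)) => //; rewrite -xt.
by move=> x; apply: aux (erefl _).
Qed.

Lemma tle_pi t : tle (repr (\pi_On t)) t /\ tle t (repr (\pi_On t)).
Proof.
by have /eqmodP/asboolP : repr (\pi_On t) = t %[mod On] by rewrite reprK.
Qed.

Lemma On_leNode I (f : I -> tree) (y : On) :
  \pi_On (Node f) <= y <-> forall i, \pi_On (f i) < y.
Proof.
have [pf fp] := tle_pi (Node f); split=> [/asboolP fy i|fy].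
  apply/On_ltP => yf; have /tltP : exists i, tle (repr y) (f i).
    by exists i; apply: tle_trans yf (tle_pi _).1.
  by apply; apply: tle_trans fp fy.
apply/asboolP; apply: tle_trans pf _; apply: contrapT => /tltP[i yf].
by have /On_ltP := fy i; apply; apply: tle_trans yf (tle_pi _).2.
Qed.

Lemma On_bounded (I : Type) (F : I -> On) : exists y, forall i, F i < y.
Proof.
exists (\pi_On (Node (fun i => repr (F i)))) => i.
rewrite -[F i]reprK.
exact: (On_leNode (fun i => repr (F i)) _).1 (lexx _) i.
Qed.

(* All nodes of a tree other than its root; a small type. *)
Fixpoint nodes (t : tree) : Type :=
  match t with Node A f => {i : A & option (nodes (f i))} end.

Fixpoint node_at (t : tree) : nodes t -> tree :=
  match t return nodes t -> tree with
  | Node A f => fun p => if projT2 p is Some q then node_at q else f (projT1 p)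
  end.

Lemma node_atP (x : On) : forall y, y < x ->
  exists p : nodes (repr x), \pi_On (node_at p) = y.
Proof.
have aux t : forall y : On, ~ tle t (repr y) ->
    exists p : nodes t, \pi_On (node_at p) = y.
  elim: t => I f IH y /tltP[i yf].
  have [fy|fy] := pselect (tle (f i) (repr y)).
    exists (existT _ i None); rewrite -[RHS]reprK.
    by apply/eqmodP/asboolP.
  by have [p py] := IH i y fy; exists (existT _ i (Some p)).
by move=> y /On_ltP; apply: aux.
Qed.

(* Replacement: the image of a proper initial segment is bounded. *)
Lemma On_image_bounded (F : On -> On) (x : On) :
  has_ubound (F @` [set y | y < x]).
Proof.
have [z zP] := On_bounded (fun p : nodes (repr x) => F (\pi_On (node_at p))).
by exists z => _ [y /node_atP[p <-] <-]; apply/ltW.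
Qed.

Lemma On_ex_min (A : set On) : A !=set0 -> exists x, A x /\ lbound A x.
Proof.
move=> [x]; elim/(well_founded_ind On_lt_wf): x => x IH Ax.
have [[y [Ay yx]]|nA] := pselect (exists y, A y /\ y < x); first exact: IH yx Ay.
exists x; split=> // y Ay; rewrite leNgt; apply/negP => yx.
by apply: nA; exists y.
Qed.

Lemma On_has_lub (A : set On) : has_ubound A -> supremums A !=set0.
Proof. by case/On_ex_min=> x [? ?]; exists x. Qed.

Definition ozero : On := \pi_On (Node (of_void tree)).
Definition osucc (x : On) : On := \pi_On (Node (fun _ : unit => repr x)).
Definition osup (A : set On) : On := supremum ozero A.

Definition is_succ (x : On) : Prop := exists y, x = osucc y.
Definition is_limit (x : On) : Prop := x <> ozero /\ ~ is_succ x.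

Lemma ozero_le x : ozero <= x.
Proof. by apply/On_leNode; case. Qed.

Lemma osucc_le x y : (osucc x <= y) = (x < y).
Proof.
apply/idP/idP => [/On_leNode/(_ tt)|xy]; first by rewrite reprK.
by apply/On_leNode => _; rewrite reprK.
Qed.

Lemma lt_osucc x : x < osucc x.
Proof. by rewrite -osucc_le. Qed.

Lemma lt_osuccE x y : (x < osucc y) = (x <= y).
Proof. by rewrite ltNge osucc_le -leNgt. Qed.

Lemma osucc_inj : injective osucc.
Proof.
move=> x y xy; apply/le_anti; rewrite -lt_osuccE -xy lt_osuccE lexx /=.
by rewrite -lt_osuccE xy lt_osucc.
Qed.

Lemma osup_lub (A : set On) : has_ubound A -> isLub A (osup A).
Proof.
move=> ubA; rewrite /osup /supremum; case: ifPn => [/eqP->|_].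
  by split=> [x []//|x _]; apply: ozero_le.
by have /xgetPex-/(_ ozero)[] := On_has_lub ubA.
Qed.

Section Recursion.
Variables (z : On) (s : On -> On).

Definition orec_step (x : On) (r : forall y, y < x -> On) : On :=
  match pselect (is_succ x) with
  | left h => let: exist y e := cid h in
      s (r y (eq_ind_r (fun x => y < x) (lt_osucc y) e))
  | right _ => if x == ozero then z
               else osup [set w | exists y (h : y < x), w = r y h]
  end.

(* Transfinite recursion; its clauses are [orec0], [orecS] and [orec_lim]. *)
Definition orec : On -> On := Fix On_lt_wf (fun _ => On) orec_step.

Lemma orecE x : orec x = orec_step (fun y (_ : y < x) => orec y).
Proof.
rewrite /orec Fix_eq// => {}x f g fg.
by congr orec_step; apply: functional_extensionality_dep => y;
  apply: functional_extensionality_dep => h.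
Qed.

Lemma orec0 : orec ozero = z.
Proof.
rewrite orecE /orec_step eqxx; case: pselect => // -[y y0]; exfalso.
by have := lt_osucc y; rewrite -y0 ltNge ozero_le.
Qed.

Lemma orecS x : orec (osucc x) = s (orec x).
Proof.
rewrite orecE /orec_step; case: pselect => [h|[]]; last by exists x.
by case: cid => y /osucc_inj ->.
Qed.

Lemma orec_lim x : is_limit x -> orec x = osup (orec @` [set y | y < x]).
Proof.
move=> [/eqP/negPf x0 xS]; rewrite orecE /orec_step x0.
case: pselect => // _; congr osup; apply/seteqP.
by split=> w [y]; [case=> yx ->; exists y|move=> yx <-; exists y, yx].
Qed.

End Recursion.

Definition oone : On := osucc ozero.
Definition omega : On := osup (range (fun n : nat => iter n osucc ozero)).
Definition oadd (x : On) : On -> On := orec x osucc.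
Definition omul (x : On) : On -> On := orec ozero (oadd^~ x).
Definition omega_exp : On -> On := orec oone (omul^~ omega).

Definition is_normal (f : On -> On) : Prop :=
  {homo f : x y / x < y} /\
  forall l, is_limit l -> f l = osup (f @` [set x | x < l]).

Definition weak_hyperation (f : On -> On) (g : On -> On -> On) : Prop :=
  [/\ forall x, is_normal (g x),
      g ozero = id,
      g oone = f &
      forall x y, g (oadd x y) = g x \o g y].

Definition is_hyperation (f : On -> On) (g : On -> On -> On) : Prop :=
  weak_hyperation f g /\
  forall h, weak_hyperation f h -> forall x z, g x z <= h x z.

Definition enumerates (e : On -> On) (C : set On) : Prop :=
  {homo e : x y / x < y} /\ range e = C.

Definition is_veblen (f : On -> On) (v : On -> On -> On) : Prop :=
  v ozero = f /\
  forall a, ozero < a ->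
    is_normal (v a) /\
    enumerates (v a) [set x | forall b, b < a -> v b x = x].

(* Main.v *)
Require Import Defs.
From mathcomp Require Import all_boot all_order.
From mathcomp Require Import boolp classical_sets.

(** The compositions [veb a1 \o ... \o veb an] read off Cantor normal forms
    form a weak hyperation, because [veb b \o veb a = veb a] whenever [b < a],
    exactly as [omega^b + omega^a = omega^a]; minimality of the hyperation then
    gives [hyp (omega^a) <= veb a].  Conversely, by induction on [a], the same
    absorption law makes every value of [hyp (omega^a)] a fixed point of all
    [veb b] with [b < a], so that [veb a <= hyp (omega^a)]. *)

Set Implicit Arguments.
Unset Strict Implicit.
Unset Printing Implicit Defensive.

Import Order.TTheory.
Local Open Scope order_scope.
Local Open Scope classical_set_scope.

(** * Suprema, induction and limit ordinals *)

Lemma osup_ub (A : set On) x : has_ubound A -> A x -> x <= osup A.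
Proof. by case/osup_lub => ubA _; apply: ubA. Qed.

Lemma lt_osup (A : set On) x : has_ubound A -> x < osup A ->
  exists2 y, A y & x < y.
Proof.
move=> /osup_lub[_ leastA] xA; apply: contrapT => nA.
suff : osup A <= x by rewrite leNgt xA.
by apply: leastA => y Ay; rewrite leNgt; apply/negP => xy; apply: nA; exists y.
Qed.

Lemma On_ind (P : On -> Prop) :
  P ozero -> (forall x, P x -> P (osucc x)) ->
  (forall l, is_limit l -> (forall x, x < l -> P x) -> P l) -> forall x, P x.
Proof.
move=> P0 PS Pl; elim/(well_founded_ind On_lt_wf) => x IH.
have [[y xy]|xS] := pselect (is_succ x).
  by rewrite xy; apply/PS/IH; rewrite xy lt_osucc.
have [->//|x0] := eqVneq x ozero.
by apply: Pl => //; split=> //; apply/eqP.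
Qed.

Lemma gt_ozero x : (ozero < x) = (x != ozero).
Proof. by rewrite lt_neqAle ozero_le andbT eq_sym. Qed.

Lemma limit_gt0 l : is_limit l -> ozero < l.
Proof. by case=> /eqP; rewrite gt_ozero. Qed.

Lemma osucc_lt_limit l x : is_limit l -> x < l -> osucc x < l.
Proof.
move=> [_ lS] xl; rewrite lt_neqAle osucc_le xl andbT.
by apply/eqP => xSl; apply: lS; exists x.
Qed.

Lemma limitP l : ozero < l -> (forall x, x < l -> osucc x < l) -> is_limit l.
Proof.
move=> l0 lS; split=> [l0'|[y ly]]; first by rewrite l0' ltxx in l0.
by have := lS y; rewrite ly lt_osucc ltxx => /(_ isT).
Qed.

(** * Increasing and normal functions *)

Lemma homo_lt_le_id (f : On -> On) x : {homo f : x y / x < y} -> x <= f x.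
Proof.
move=> fh; elim/(well_founded_ind On_lt_wf): x => x IH.
rewrite leNgt; apply/negP => fx.
by have := IH _ fx; rewrite leNgt fh.
Qed.

Section Normal.
Variables (f : On -> On) (fn : is_normal f).

Lemma normal_le : {mono f : x y / x <= y}.
Proof. by apply: le_mono; case: fn. Qed.

Lemma normal_lt : {mono f : x y / x < y}.
Proof. exact: leW_mono normal_le. Qed.

Lemma normal_le_id x : x <= f x.
Proof. by apply: homo_lt_le_id; case: fn. Qed.

Lemma lt_normal_limit l z : is_limit l -> z < f l -> exists2 x, x < l & z < f x.
Proof.
case: fn => _ fl ll; rewrite fl// => /lt_osup[|_ [x xl <-] zx].
  exact: On_image_bounded.
by exists x.
Qed.

Lemma normal_is_limit l : is_limit l -> is_limit (f l).
Proof.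
move=> ll; apply: limitP.
  exact: lt_le_trans (limit_gt0 ll) (normal_le_id l).
move=> x /(lt_normal_limit ll)[y yl xy].
by apply: (@le_lt_trans _ _ (f y)); rewrite ?osucc_le ?normal_lt.
Qed.

(** The least [c] with [y < f c] is neither [ozero], as [f ozero <= y], nor a limit, by continuity;
    its predecessor is the required point. This provides both subtraction and leading exponents. *)
Lemma normal_floor y : f ozero <= y -> exists x, f x <= y < f (osucc x).
Proof.
move=> f0y.
have [|c [yc cmin]] := @On_ex_min [set c | y < f c].
  by exists (osucc y); rewrite /= -osucc_le normal_le_id.
have below x : x < c -> f x <= y.
  by move=> xc; rewrite leNgt; apply/negP => /cmin; rewrite leNgt xc.
have [[x cx]|cS] := pselect (is_succ c).
  by exists x; rewrite -cx yc andbT below// cx lt_osucc.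
have [c0|/eqP c0] := eqVneq c ozero; first by move: yc; rewrite /= c0 ltNge f0y.
have [x xc] := @lt_normal_limit c y (conj c0 cS) yc.
by rewrite ltNge below.
Qed.

End Normal.

Lemma normalP (f : On -> On) : {homo f : x y / x < y} ->
  (forall l z, is_limit l -> z < f l -> exists2 x, x < l & z < f x) ->
  is_normal f.
Proof.
move=> fh fl; split=> // l ll; have ub := On_image_bounded f l.
apply/le_anti/andP; split.
  rewrite leNgt; apply/negP => /(fl _ _ ll)[x xl].
  by rewrite ltNge osup_ub//; exists x.
by have [_] := osup_lub ub; apply=> _ [x xl <-]; apply/ltW/fh.
Qed.

Lemma normal_id : is_normal id.
Proof.
apply: normalP => // l z ll zl; exists (osucc z); last exact: lt_osucc.
exact: osucc_lt_limit.
Qed.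

Lemma normal_comp (f g : On -> On) :
  is_normal f -> is_normal g -> is_normal (f \o g).
Proof.
move=> fn gn; apply: normalP => [x y xy|l z ll] /=.
  by rewrite normal_lt// normal_lt.
move=> /(lt_normal_limit fn (normal_is_limit gn ll))[y].
move=> /(lt_normal_limit gn ll)[x xl yx] zy; exists x => //.
by apply: (lt_trans zy); rewrite normal_lt.
Qed.

Lemma normal_ext (f g : On -> On) : is_normal f -> is_normal g ->
  f ozero = g ozero -> (forall x, f x = g x -> f (osucc x) = g (osucc x)) ->
  f =1 g.
Proof.
move=> fn gn fg0 fgS; apply: On_ind => // l ll IH.
rewrite fn.2// gn.2//; congr osup; apply/seteqP.
by split=> _ [x xl <-]; exists x => //; rewrite IH.
Qed.

(** The step need only increase from the starting value on: [omul^~ omega], the step of [omega_exp],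
    fixes [ozero] but increases every positive ordinal. *)
Lemma orec_normal z s : (forall x, z <= x -> x < s x) -> is_normal (orec z s).
Proof.
move=> sgt; set f := orec z s.
have fl l y : is_limit l -> y < l -> f y <= f l.
  move=> ll yl; rewrite /f (orec_lim _ _ ll).
  by apply: osup_ub; [exact: On_image_bounded|exists y].
have zf x : z <= f x.
  elim/On_ind: x => [|x zx|l ll _]; first by rewrite /f orec0.
    by rewrite /f orecS (le_trans zx)// ltW// sgt.
  by have := fl _ _ ll (limit_gt0 ll); rewrite {1}/f orec0.
have fS x : f x < f (osucc x) by rewrite /f orecS sgt// zf.
apply: normalP => [x y|l w ll].
  elim/On_ind: y => [|y IH|l ll _].
  - by rewrite ltNge ozero_le.
  - rewrite lt_osuccE le_eqVlt => /predU1P[->//|/IH xy].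
    exact: lt_trans xy (fS y).
  - move=> xl; apply: lt_le_trans (fS x) _.
    by apply: fl => //; apply: osucc_lt_limit.
rewrite {1}/f orec_lim// => /lt_osup[|_ [x xl <-] wx].
  exact: On_image_bounded.
by exists x.
Qed.

(** * Ordinal addition *)

Lemma oadd_normal x : is_normal (oadd x).
Proof. by apply: orec_normal => y _; apply: lt_osucc. Qed.

Lemma oaddx0 x : oadd x ozero = x. Proof. exact: orec0. Qed.

Lemma oaddxS x y : oadd x (osucc y) = osucc (oadd x y).
Proof. exact: orecS. Qed.

Lemma oadd0x x : oadd ozero x = x.
Proof.
apply: (normal_ext (oadd_normal _) normal_id) x; first exact: oaddx0.
by move=> x /= xx; rewrite oaddxS xx.
Qed.

Lemma oaddA : associative oadd.
Proof.
move=> x y z; apply: (@normal_ext (oadd x \o oadd y)) z.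
- exact: normal_comp (oadd_normal _) (oadd_normal _).
- exact: oadd_normal.
- by rewrite /= !oaddx0.
- by move=> z /= e; rewrite !oaddxS e.
Qed.

Lemma oaddI x : injective (oadd x).
Proof. exact: inc_inj (normal_le (oadd_normal x)). Qed.

Lemma le_oaddr x y : y <= oadd x y.
Proof. exact: normal_le_id (oadd_normal x) y. Qed.

Lemma lt_oaddl x y : ozero < y -> x < oadd x y.
Proof. by move=> y0; rewrite -{1}[x]oaddx0 normal_lt//; apply: oadd_normal. Qed.

Lemma le_oaddE x y : x <= y -> exists z, y = oadd x z.
Proof.
move=> xy; have [|z] := @normal_floor _ (oadd_normal x) y.
  by rewrite oaddx0.
by rewrite oaddxS lt_osuccE => xzy; exists z; apply/le_anti; rewrite andbC.
Qed.

(** * The ordinal omega and multiplication by it *)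

Notation onat n := (iter n osucc ozero).

Lemma onat_ub : has_ubound (range (fun n : nat => onat n)).
Proof.
have [y yP] := On_bounded (fun n : nat => onat n).
by exists y => _ [n _ <-]; apply/ltW.
Qed.

Lemma lt_omegaP x : x < omega -> exists n : nat, x < onat n.
Proof. by move/(lt_osup onat_ub) => [_ [n _ <-]]; exists n. Qed.

Lemma onat_lt_omega n : onat n < omega.
Proof.
apply: lt_le_trans (lt_osucc _) _.
by apply: (osup_ub onat_ub); exists n.+1.
Qed.

Lemma omega_limit : is_limit omega.
Proof.
apply: limitP => [|x /lt_omegaP[n xn]]; first exact: (onat_lt_omega 0).
by apply: le_lt_trans (onat_lt_omega n); rewrite osucc_le.
Qed.

Section MulOmega.
Variables (x : On) (x0 : ozero < x).

Lemma omul_normal : is_normal (omul x).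
Proof. by apply: orec_normal => y _; apply: lt_oaddl. Qed.

Lemma omulx0 : omul x ozero = ozero. Proof. exact: orec0. Qed.

Lemma omulxS y : omul x (osucc y) = oadd (omul x y) x. Proof. exact: orecS. Qed.

(** Recursion adds the new copy of [x] on the right; for finite multiples associativity moves it to
    the left, where absorption needs it. *)
Lemma omul_onatS n : omul x (onat n.+1) = oadd x (omul x (onat n)).
Proof.
elim: n => [|n IH]; first by rewrite /= omulxS omulx0 oadd0x oaddx0.
by rewrite [LHS]omulxS [in LHS]IH -oaddA -omulxS.
Qed.

Lemma lt_omul_omegaP z :
  z < omul x omega -> exists n : nat, z < omul x (onat n).
Proof.
move/(lt_normal_limit omul_normal omega_limit) => [y /lt_omegaP[n yn] zy].
by exists n; apply: (lt_trans zy); rewrite normal_lt//; apply: omul_normal.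
Qed.

Lemma omul_onat_lt n : omul x (onat n) < omul x omega.
Proof. by rewrite normal_lt ?onat_lt_omega//; apply: omul_normal. Qed.

Lemma oadd_lt_omul_omega z : z < omul x omega -> oadd x z < omul x omega.
Proof.
move=> /lt_omul_omegaP[n zn]; apply: lt_trans (omul_onat_lt n.+1).
by rewrite omul_onatS normal_lt//; apply: oadd_normal.
Qed.

(** Adding [x] on the left maps the ordinals below the limit [omul x omega] to ordinals below it, so
    by continuity its value at that limit cannot exceed it. *)
Lemma oadd_omul_omega : oadd x (omul x omega) = omul x omega.
Proof.
apply/le_anti; rewrite le_oaddr andbT leNgt; apply/negP.
have ll := normal_is_limit omul_normal omega_limit.
move/(lt_normal_limit (oadd_normal x) ll) => [z /oadd_lt_omul_omega zx].
by rewrite ltNge ltW.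
Qed.

(** If [x + z = z], then [z] lies above every finite multiple of [x]. The strict inequality makes
    the remainder of a split smaller than the ordinal split. *)
Lemma lt_oadd_omul_omega z : z < omul x omega -> z < oadd x z.
Proof.
move=> zx; rewrite lt_neqAle le_oaddr andbT; apply/eqP => zz.
have [n] := lt_omul_omegaP zx; suff /le_gtF-> : omul x (onat n) <= z by [].
elim: n => [|n IH]; first by rewrite omulx0 ozero_le.
by rewrite omul_onatS zz normal_le//; apply: oadd_normal.
Qed.

Lemma lt_omul_omega : x < omul x omega.
Proof. by have := omul_onat_lt 1; rewrite omul_onatS omulx0 oaddx0. Qed.

End MulOmega.

(** * Powers of omega and leading terms *)

Lemma omega_exp_normal : is_normal omega_exp.
Proof. by apply: orec_normal => x; rewrite osucc_le; apply: lt_omul_omega. Qed.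

Lemma omega_exp0 : omega_exp ozero = oone. Proof. exact: orec0. Qed.

Lemma omega_expS a : omega_exp (osucc a) = omul (omega_exp a) omega.
Proof. exact: orecS. Qed.

Lemma omega_exp_gt0 a : ozero < omega_exp a.
Proof.
rewrite -osucc_le -/oone -omega_exp0 normal_le ?ozero_le//.
exact: omega_exp_normal.
Qed.

(** Write [omega^a] as [omega^(b+1) + z]: the first summand is [omega^b * omega], which absorbs
    [omega^b]. *)
Lemma oadd_omega_exp b a : b < a ->
  oadd (omega_exp b) (omega_exp a) = omega_exp a.
Proof.
rewrite -osucc_le -(normal_le omega_exp_normal) => /le_oaddE[z ->].
by rewrite oaddA omega_expS oadd_omul_omega// omega_exp_gt0.
Qed.

Lemma oadd_lt_omega_expS a y : y < omega_exp (osucc a) ->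
  oadd (omega_exp a) y < omega_exp (osucc a).
Proof. by rewrite omega_expS; apply/oadd_lt_omul_omega/omega_exp_gt0. Qed.

(** The second clause supports a well-founded recursion; the third says that the remainder has no
    exponent above the leading one, which makes the split unique. *)
Lemma omega_exp_split x : ozero < x -> exists p : On * On,
  [/\ x = oadd (omega_exp p.1) p.2, p.2 < x & p.2 < omega_exp (osucc p.1)].
Proof.
move=> x0; have [|a /andP[ax xa]] := @normal_floor _ omega_exp_normal x.
  by rewrite omega_exp0 osucc_le.
have [y xy] := le_oaddE ax.
have ya : y < omega_exp (osucc a) by apply: le_lt_trans xa; rewrite xy le_oaddr.
exists (a, y); split=> //=; rewrite xy.
by apply: lt_oadd_omul_omega; rewrite ?omega_exp_gt0 -?omega_expS.
Qed.

(** Each sum lies below the next power of omega, so each exponent bounds the other; left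
    cancellation does the rest. Hence [cnf_comp] does not depend on the split that [cid] picks. *)
Lemma omega_exp_split_inj a b x y :
  x < omega_exp (osucc a) -> y < omega_exp (osucc b) ->
  oadd (omega_exp a) x = oadd (omega_exp b) y -> a = b /\ x = y.
Proof.
have le_exp c d u v : v < omega_exp (osucc d) ->
    oadd (omega_exp c) u = oadd (omega_exp d) v -> c <= d.
  move=> /oadd_lt_omega_expS vd e.
  rewrite -lt_osuccE -(normal_lt omega_exp_normal); apply: le_lt_trans vd.
  rewrite -e -{1}[omega_exp c]oaddx0 normal_le ?ozero_le//.
  exact: oadd_normal.
move=> xa yb e; have ab : a = b.
  by apply/le_anti/andP; split; [exact: le_exp yb e|exact: le_exp xa (esym e)].
by split=> //; move: e; rewrite ab => /oaddI.
Qed.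

(** * Compositions along Cantor normal forms *)

(* [cnf_comp v alpha] is [v a1 \o ... \o v an] for the Cantor normal form
   [alpha = omega^a1 + ... + omega^an]. *)
Section CnfComp.
Variable v : On -> On -> On.

Definition cnf_step x (r : forall y, y < x -> On -> On) : On -> On :=
  match pselect (ozero < x) with
  | left x0 => let: exist p P := cid (omega_exp_split x0) in
      v p.1 \o r p.2 (let: And3 _ h _ := P in h)
  | right _ => id
  end.

Definition cnf_comp : On -> On -> On :=
  Fix On_lt_wf (fun _ => On -> On) cnf_step.

Lemma cnf_compE x : cnf_comp x = cnf_step (fun y (_ : y < x) => cnf_comp y).
Proof.
rewrite /cnf_comp Fix_eq// => {}x f g fg.
by congr cnf_step; apply: functional_extensionality_dep => y;
  apply: functional_extensionality_dep => h.
Qed.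

Lemma cnf_comp0 : cnf_comp ozero = id.
Proof.
rewrite cnf_compE /cnf_step; case: pselect => // h.
by exfalso; rewrite ltxx in h.
Qed.

Lemma cnf_comp_lead a x : x < omega_exp (osucc a) ->
  cnf_comp (oadd (omega_exp a) x) = v a \o cnf_comp x.
Proof.
move=> xa; rewrite cnf_compE /cnf_step; case: pselect => [h|[]].
  case: cid => -[b y] /= [e _ yb].
  by have [<- <-] := omega_exp_split_inj xa yb e.
apply: lt_le_trans (omega_exp_gt0 a) _; rewrite -{1}[omega_exp a]oaddx0.
by rewrite normal_le ?ozero_le//; apply: oadd_normal.
Qed.

Lemma cnf_comp_omega_exp a : cnf_comp (omega_exp a) = v a.
Proof.
by rewrite -[omega_exp a]oaddx0 cnf_comp_lead ?omega_exp_gt0// cnf_comp0.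
Qed.

Lemma cnf_ind (P : On -> Prop) : P ozero ->
  (forall a x, x < omega_exp (osucc a) -> P x -> P (oadd (omega_exp a) x)) ->
  forall x, P x.
Proof.
move=> P0 PS; elim/(well_founded_ind On_lt_wf) => x IH.
have [->//|] := eqVneq x ozero; rewrite -gt_ozero => /omega_exp_split[[a y]] /=.
by case=> xy yx ya; rewrite xy; apply: PS => //; apply: IH.
Qed.

Hypothesis v_absorb : forall b a, b < a -> v b \o v a = v a.

(** The remainder may now be arbitrary. If its leading exponent exceeds [b], both [omega^b] and
    [v b] are absorbed; otherwise [omega^b] is itself a leading term. *)
Lemma cnf_comp_omega_exp_add b x :
  cnf_comp (oadd (omega_exp b) x) = v b \o cnf_comp x.
Proof.
elim/cnf_ind: x => [|a x xa _].
  by rewrite cnf_comp_lead ?omega_exp_gt0.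
have [ba|ab] := ltP b a.
  by rewrite oaddA oadd_omega_exp// cnf_comp_lead// -[in LHS](v_absorb ba).
apply: cnf_comp_lead; apply: lt_le_trans (oadd_lt_omega_expS xa) _.
by rewrite (normal_le omega_exp_normal) osucc_le lt_osuccE.
Qed.

Lemma cnf_comp_add x y : cnf_comp (oadd x y) = cnf_comp x \o cnf_comp y.
Proof.
elim/cnf_ind: x => [|a x _ IH]; first by rewrite oadd0x cnf_comp0.
by rewrite -oaddA !cnf_comp_omega_exp_add IH.
Qed.

Lemma cnf_comp_weak_hyperation :
  (forall a, is_normal (v a)) -> weak_hyperation (v ozero) cnf_comp.
Proof.
move=> vn; split; [|exact: cnf_comp0| |exact: cnf_comp_add].
  elim/cnf_ind => [|a x xa IH]; first by rewrite cnf_comp0; apply: normal_id.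
  by rewrite cnf_comp_lead//; apply: normal_comp.
by rewrite -omega_exp0 cnf_comp_omega_exp.
Qed.

End CnfComp.

(** * Veblen functions as values of the hyperation *)

(** Since [g] takes values in the range of [e], it factors as [e \o k]; then [k] is strictly
    increasing, so [x <= k x]. *)
Lemma enumerates_le (e g : On -> On) (C : set On) : enumerates e C ->
  {homo g : x y / x < y} -> range g `<=` C -> forall x, e x <= g x.
Proof.
move=> [eh eC] gh gC; have em : {mono e : x y / x <= y} by apply: le_mono.
have /choice[k kP] : forall x, exists y, e y = g x.
  move=> x; have : C (g x) by apply: gC; exists x.
  by rewrite -eC => -[y _ yx]; exists y.
move=> x; rewrite -kP em; apply: homo_lt_le_id => {}x y xy.
by rewrite -(leW_mono em) !kP gh.
Qed.

Section Veblen.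
Variables (f : On -> On) (veb : On -> On -> On).
Hypotheses (fn : is_normal f) (fveb : is_veblen f veb).

Lemma veblen_normal a : is_normal (veb a).
Proof.
case: fveb => veb0 vebS; have [->|] := eqVneq a ozero; first by rewrite veb0.
by rewrite -gt_ozero => /vebS[].
Qed.

Lemma veblen_absorb b a : b < a -> veb b \o veb a = veb a.
Proof.
move=> ba; apply/funext => x /=.
have [_ [_ vebC]] := fveb.2 _ (le_lt_trans (ozero_le b) ba).
have : range (veb a) (veb a x) by exists x.
by rewrite vebC => /(_ _ ba).
Qed.

Lemma hyperation_omega_exp hyp a :
  is_hyperation f hyp -> hyp (omega_exp a) = veb a.
Proof.
move=> [[hn h0 h1 hD] hmin]; have [veb0 vebS] := fveb.
elim/(well_founded_ind On_lt_wf): a => a IH.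
have [->|] := eqVneq a ozero; first by rewrite omega_exp0 h1 veb0.
rewrite -gt_ozero => /vebS[_ vebE].
apply/funext => x; apply/le_anti/andP; split.
  rewrite -[veb a](cnf_comp_omega_exp veb) hmin// -veb0.
  exact: cnf_comp_weak_hyperation veblen_absorb veblen_normal.
apply: enumerates_le vebE _ _ x; first by case: (hn (omega_exp a)).
move=> _ [y _ <-] b ba.
(* By induction [veb b] is [hyp (omega_exp b)], so applying it to the value [hyp (omega_exp a) y]
   amounts to adding [omega^b] to the left of [omega^a]. *)
by rewrite -IH// -[LHS]/((hyp _ \o hyp _) y) -hD oadd_omega_exp.
Qed.

End Veblen.

Theorem corollary4p10 (f : On -> On) (hyp veb : On -> On -> On) :
  is_normal f -> is_hyperation f hyp -> is_veblen f veb ->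
  forall (n : nat) (a : 'I_n -> On) (alpha : On),
    alpha = \big[oadd/ozero]_(i < n) omega_exp (a i) ->
    forall zeta : On,
      hyp alpha zeta = (\big[@comp On On On/id]_(i < n) veb (a i)) zeta.
Proof.
move=> fn fhyp fveb n a _ -> zeta; have [[_ h0 _ hD] _] := fhyp.
(* Peel off the first exponent: additivity of [hyp] turns the sum into a composition, and the empty
   sum gives the identity. *)
elim: n a => [|n IH] a; first by rewrite !big_ord0 h0.
by rewrite !big_ord_recl hD /= (hyperation_omega_exp fn fveb)// IH.
Qed.
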